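(* Let $\mathcal{H}=\{rrr,bbr,yyb\}$. Then, for every positive integer $n$, $h_2(n,\mathcal{H})=\left\lceil \tfrac{3n}{7}\right\rceil+\epsilon_1(n)$, where $\epsilon_1(n)=1$ if $n\equiv 2\pmod 7$ and $\epsilon_1(n)=0$ otherwise.
   Context: Edge-colorings of the complete graph $K_n$ use colors from $\{r,b,y\}$ (red, blue, yellow); they need not be proper, and not all colors need be used. A pattern is an edge-colored triangle, denoted by the multiset of the colors of its three edges; e.g. $rrr$ is the all-red triangle, $bbr$ is the triangle with two blue edges and one red edge, and $yyb$ has two yellow edges and one blue edge. For a family $\mathcal{H}$ of patterns, $\operatorname{Forb}(n,\mathcal{H})$ is the set of all edge-colorings of $K_n$ with colors from $\{r,b,y\}$ in which no triangle has a coloring belonging to $\mathcal{H}$. For an edge-coloring $c$ of $K_n$, $h_2(c)$ is the maximum $k$ such that there is a set of $k$ vertices whose induced edges use at most two of the three colors. Finally, $h_2(n,\mathcal{H})=\min\{h_2(c): c\in\operatorname{Forb}(n,\mathcal{H})\}$. *)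

(* Defs.v *)
From HB Require Import structures.
From mathcomp Require Import all_boot all_order all_algebra.
Set Implicit Arguments.
Unset Strict Implicit.
Unset Printing Implicit Defensive.

Inductive color := Red | Blue | Yellow.

Definition color_to_ord (a : color) : 'I_3 :=
  match a with Red => inord 0 | Blue => inord 1 | Yellow => inord 2 end.

Definition ord_to_color (i : 'I_3) : color :=
  match val i with 0 => Red | 1 => Blue | _ => Yellow end.

Lemma color_to_ordK : cancel color_to_ord ord_to_color.
Proof. by case; rewrite /ord_to_color /= inordK. Qed.

HB.instance Definition _ := Countable.copy color (can_type color_to_ordK).
HB.instance Definition _ : isFinite color := CanIsFinite color_to_ordK.

(* A multiset of three colors: a triple, always compared up to perm_eq. *)
Definition pattern := 3.-tuple color.

Definition edge (n : nat) := {e : {set 'I_n} | #|e| == 2}.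

Definition coloring (n : nat) := {ffun edge n -> color}.

(* Listed with multiplicity; for #|T| = 3 this list has length 3 and represents
   the pattern of the triangle T. *)
Definition edge_colors (n : nat) (c : coloring n) (T : {set 'I_n}) : seq color :=
  [seq c e | e : edge n <- enum {: edge n} & val e \subset T].

Definition Forb (n : nat) (H : seq pattern) : {set coloring n} :=
  [set c | [forall T : {set 'I_n}, (#|T| == 3) ==>
             ~~ has (fun p : pattern => perm_eq (edge_colors c T) p) H]].

Definition color_set (n : nat) (c : coloring n) (S : {set 'I_n}) : {set color} :=
  [set c e | e : edge n & val e \subset S].

Definition h2 (n : nat) (c : coloring n) : nat :=
  \max_(S : {set 'I_n} | #|color_set c S| <= 2) #|S|.

(* Since h2 c <= n for every c, starting the iterated minimum at n does not
   affect its value as soon as Forb n H is nonempty: see h2_min_attained and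
   h2_min_le. *)
Definition h2_min (n : nat) (H : seq pattern) : nat :=
  \big[minn/n]_(c in Forb n H) h2 c.

Lemma h2_le_n (n : nat) (c : coloring n) : h2 c <= n.
Proof.
by apply/bigmax_leqP => S _; rewrite -[leqRHS]card_ord; apply: max_card.
Qed.

Lemma h2_min_le (n : nat) (H : seq pattern) (c : coloring n) :
  c \in Forb n H -> h2_min n H <= h2 c.
Proof.
move=> cF; rewrite /h2_min -big_filter.
have: c \in [seq d <- index_enum (coloring n) | d \in Forb n H].
  by rewrite mem_filter cF mem_index_enum.
elim: [seq _ <- _ | _] => // d s IHs; rewrite inE big_cons geq_min.
by case/predU1P => [->|/IHs ->]; rewrite ?leqnn ?orbT.
Qed.

Lemma h2_min_attained (n : nat) (H : seq pattern) :
  Forb n H != set0 -> exists2 c, c \in Forb n H & h2 c = h2_min n H.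
Proof.
case/set0Pn => c0 c0F.
have [c cF cmin] := arg_minnP (@h2 n) c0F.
exists c => //; apply/eqP; rewrite eqn_leq h2_min_le // andbT.
rewrite /h2_min; elim/big_ind: _ => [|x y cx cy|d dF].
- exact: h2_le_n.
- by rewrite leq_min cx.
- exact: cmin.
Qed.

Definition epsilon1 (n : nat) : nat := if n == 2 %[mod 7] then 1 else 0.

(* Main.v *)
Require Import Defs.
From mathcomp Require Import all_boot all_order all_algebra zify lra.
Set Implicit Arguments.
Unset Strict Implicit.
Unset Printing Implicit Defensive.

(** Lower bound. If some triangle xyz is blue, then the vertices with a red edge
    to {x, y, z} and those without split the vertices into two sets spanning no
    red edge, one of which has at least n/2 vertices. Otherwise, if there is no
    odd closed blue walk, the blue graph is bipartite and again n/2 is reached.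
    In the remaining case a shortest odd closed blue walk has length 7: in a walk
    of length m = 5 or m >= 9, chords at even distance would be yellow and chords
    at odd distance >= 3 red, but distance m - 2 is also distance 2. Its vertices
    span the coloring of Z_7 in which differences 1, 2, 3 (up to sign)
    are blue, yellow, red. The forbidden patterns make every other vertex a twin
    of one of these seven, so the whole coloring is a blow-up of Z_7 with yellow
    inside the parts. The 7 red-free triples i, i+1, i+2 and the 7 blue-free
    triples i, i+2, i+4 cover each part three times per family, which yields
    3n/7; when n = 2 mod 7 the two families cannot both be balanced, which
    yields the extra 1.

    Upper bound. Balanced blow-ups of the same coloring of Z_7, with the larger
    parts suitably placed, and properly 3-colored cliques when n <= 4. *)

(** * Allowed triangles, the coloring of [Z_7] and its finite checks *)

Definition allowed (a b c : color) : bool :=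
  match a, b, c with
  | Red, Red, Red
  | Blue, Blue, Red | Blue, Red, Blue | Red, Blue, Blue
  | Yellow, Yellow, Blue | Yellow, Blue, Yellow | Blue, Yellow, Yellow => false
  | _, _, _ => true
  end.

(** The color depends only on [i - j] modulo 7; adding 7 first keeps the truncated subtraction exact
    for [j < 7]. Difference 0 is yellow, the color inside the parts of a blow-up. *)
Definition heptagon (i j : nat) : color :=
  match (i + 7 - j) %% 7 with
  | 0 | 2 | 5 => Yellow
  | 1 | 6 => Blue
  | _ => Red
  end.

(** An equality test that evaluates directly, for the exhaustive checks by [vm_compute]; [==] on
    [color] is transported through [color_to_ord]. *)
Definition same_color (a b : color) : bool :=
  match a, b with
  | Red, Red | Blue, Blue | Yellow, Yellow => true
  | _, _ => false
  end.

Lemma same_colorP (a b : color) : reflect (a = b) (same_color a b).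
Proof. by case: a; case: b; constructor. Qed.

Fixpoint words (T : Type) (letters : seq T) (k : nat) : seq (seq T) :=
  if k is k'.+1 then [seq x :: w | x <- letters, w <- words letters k']
  else [:: [::]].

Lemma mem_words (T : eqType) (letters w : seq T) :
  {subset w <= letters} -> w \in words letters (size w).
Proof.
elim: w => //= x w IHw sw; apply: allpairs_f; first by apply: sw; rewrite mem_head.
by apply: IHw => y yw; apply: sw; rewrite inE yw orbT.
Qed.

Definition colors := [:: Red; Blue; Yellow].

Lemma mem_colors (a : color) : a \in colors.
Proof. by rewrite !inE; case: a; rewrite eqxx ?orbT. Qed.

(** [f] lists the colors from one vertex to a copy of the heptagon. All [3^7] color words are
    tested, and those creating no forbidden triangle are rows of the heptagon. *)
Lemma heptagon_twin (f : nat -> color) :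
  (forall i j, i < 7 -> j < 7 -> allowed (f i) (f j) (heptagon i j)) ->
  exists2 i, i < 7 & forall j, j < 7 -> f j = heptagon i j.
Proof.
pose extends w := all (fun i => all (fun j =>
  allowed (nth Red w i) (nth Red w j) (heptagon i j)) (iota 0 7)) (iota 0 7).
pose twin w i := all (fun j => same_color (nth Red w j) (heptagon i j)) (iota 0 7).
have: all (fun w => extends w ==> has (twin w) (iota 0 7)) (words colors 7).
  by vm_compute.
move=> /allP check f_ok.
have nthf j : j < 7 -> nth Red [seq f i | i <- iota 0 7] j = f j.
  by move=> j7; rewrite (nth_map 0) ?size_iota // nth_iota.
have fw : [seq f i | i <- iota 0 7] \in words colors 7.
  by have := @mem_words _ colors (map f (iota 0 7)) (fun a _ => mem_colors a).
have f_ext : extends [seq f i | i <- iota 0 7].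
  apply/allP => i; rewrite mem_iota => /andP[_ i7].
  apply/allP => j; rewrite mem_iota => /andP[_ j7].
  by rewrite !nthf ?f_ok.
have := check _ fw; rewrite f_ext => /hasP[i]; rewrite mem_iota => /andP[_ i7] /allP tw.
by exists i => // j j7; rewrite -nthf //; apply/same_colorP/tw; rewrite mem_iota.
Qed.

(** Here [a] is the color between a twin of [i] and a twin of [j]; their triangles with the seven
    vertices leave one choice. The case [i = j] makes the parts yellow inside. *)
Lemma heptagon_twins (i j : nat) (a : color) : i < 7 -> j < 7 ->
  (forall k, k < 7 -> allowed a (heptagon i k) (heptagon j k)) ->
  a = heptagon i j.
Proof.
pose ok i j a := all (fun k => allowed a (heptagon i k) (heptagon j k)) (iota 0 7).
have: all (fun i => all (fun j => all (fun a =>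
    ok i j a ==> same_color a (heptagon i j)) colors) (iota 0 7)) (iota 0 7).
  by vm_compute.
move=> /allP check i7 j7 a_ok.
have /allP/(_ j) := check i ltac:(by rewrite mem_iota).
rewrite mem_iota => /(_ j7) /allP /(_ a (mem_colors a)).
rewrite (_ : ok _ _ _) => [/same_colorP //|].
by apply/allP => k; rewrite mem_iota => /a_ok.
Qed.

Lemma heptagonC (i j : nat) : i < 7 -> j < 7 -> heptagon i j = heptagon j i.
Proof.
move=> i7 j7; apply/same_colorP.
have: all (fun i => all (fun j => same_color (heptagon i j) (heptagon j i))
  (iota 0 7)) (iota 0 7) by vm_compute.
by move=> /allP/(_ i); rewrite mem_iota => /(_ i7)/allP/(_ j); rewrite mem_iota; apply.
Qed.

(** * Blue triangles and blue heptagons *)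

Section Structure.
Variables (V : finType) (col : V -> V -> color).
Hypotheses (colC : forall x y, col x y = col y x) (colxx : forall x, col x x = Yellow).
Hypothesis col_ok : forall x y z, allowed (col x y) (col y z) (col x z).

Definition avoids (a : color) (S : {set V}) : Prop :=
  {in S &, forall x y, col x y <> a}.

(** A vertex with a red edge to a blue triangle has at least two of them, and a vertex with none has
    at least two blue ones. If both ends of a red edge were of the same kind, they would share a red
    or a blue neighbor in the triangle, giving [rrr] or [bbr]. *)
Lemma blue_triangle_avoids (u v w : V) :
  col u v = Blue -> col v w = Blue -> col u w = Blue ->
  exists S : {set V}, avoids Red S /\ avoids Red (~: S).
Proof.
move=> uv vw uw.
pose red x y := same_color (col x y) Red.
exists [set x | [|| red x u, red x v | red x w]].
suff key x y : col x y = Red ->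
    [|| red x u, red x v | red x w] = ~~ [|| red y u, red y v | red y w].
  split=> x y; rewrite !inE => xS yS xy; have := key _ _ xy.
    by rewrite xS yS.
  by rewrite (negPf xS) yS.
move=> xy.
have := col_ok x u v; have := col_ok x v w; have := col_ok x u w.
have := col_ok y u v; have := col_ok y v w; have := col_ok y u w.
have := col_ok x y w; have := col_ok x y v; have := col_ok x y u.
rewrite uv vw uw xy /red.
case: (col x u); case: (col y u) => //= _; case: (col x v); case: (col y v) => //= _;
  case: (col x w); case: (col y w) => //=.
Qed.

Hypothesis no_blue_triangle :
  forall x y z, col x y = Blue -> col y z = Blue -> col x z <> Blue.

Lemma blue2_yellow (x y z : V) : col x y = Blue -> col y z = Blue -> col x z = Yellow.
Proof.
move=> xy yz; have := col_ok x y z; have := no_blue_triangle xy yz.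
by rewrite xy yz; case: (col x z).
Qed.

Lemma blue_heptagon (u : nat -> V) :
  (forall i, u (i + 7) = u i) -> (forall i, col (u i) (u i.+1) = Blue) ->
  forall i j, i < 7 -> j < 7 -> col (u i) (u j) = heptagon i j.
Proof.
move=> u7 u1.
have u2 i : col (u i) (u i.+2) = Yellow by apply: blue2_yellow (u1 i) (u1 i.+1).
have u3 i : col (u i) (u (i + 3)) = Red.
  case E: (col _ _) => //; last first.
    by have := col_ok (u i) (u i.+2) (u i.+3); rewrite u2 u1 -(addn3 i) E.
  (* Were the edge from [i] to [i + 3] blue, the vertices [i], [i + 4], [i + 6] would form the
     pattern [yyb]. *)
  have u04 : col (u i) (u (i + 4)) = Yellow.
    by apply: blue2_yellow E _; have := u1 (i + 3); rewrite -addnS.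
  have u46 : col (u (i + 4)) (u (i + 6)) = Yellow.
    by have := u2 (i + 4); rewrite -!addnS.
  have u60 : col (u (i + 6)) (u i) = Blue.
    by have := u1 (i + 6); rewrite -addnS u7.
  by have := col_ok (u i) (u (i + 4)) (u (i + 6)); rewrite u04 u46 colC u60.
have key i d : d < 7 -> col (u i) (u (i + d)) =
    match d with 0 | 2 | 5 => Yellow | 1 | 6 => Blue | _ => Red end.
  case: d => [|[|[|[|[|[|[|]]]]]]] // _; rewrite ?addn0 ?addn1 ?addn2 //.
  - by rewrite colC -(u7 i) -[7]/(4 + 3) addnA.
  - by rewrite colC -(u7 i) -[7]/(5 + 2) addnA addn2.
  - by rewrite colC -(u7 i) -[7]/(6 + 1) addnA addn1.
move=> i j i7 j7; wlog ij : i j i7 j7 / i <= j.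
  move=> H; case: (leqP i j) => [/H->//|/ltnW/H H'].
  by rewrite colC heptagonC // H'.
rewrite heptagonC // -{1}(subnKC ij) key ?(leq_ltn_trans (leq_subr _ _)) //.
rewrite /heptagon -addnBAC // modnDr modn_small //.
by rewrite (leq_ltn_trans (leq_subr _ _)).
Qed.

Lemma heptagon_blowup (u : nat -> V) :
  (forall i j, i < 7 -> j < 7 -> col (u i) (u j) = heptagon i j) ->
  exists t : V -> 'I_7, forall x y, col x y = heptagon (t x) (t y).
Proof.
move=> colu.
have ext x : exists i : 'I_7, [forall j : 'I_7, col x (u j) == heptagon i j].
  have [i j i7 j7|i i7 Hi] := @heptagon_twin (fun j => col x (u j)).
    by have := col_ok (u i) x (u j); rewrite colu // (colC (u i) x).
  by exists (Ordinal i7); apply/forallP => j; rewrite Hi.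
exists (fun x => xchoose (ext x)) => x y.
apply: heptagon_twins => // k k7.
have /forallP/(_ (Ordinal k7))/eqP /= <- := xchooseP (ext x).
have /forallP/(_ (Ordinal k7))/eqP /= <- := xchooseP (ext y).
have := col_ok x y (u k).
by case: (col x y); case: (col x (u k)); case: (col y (u k)).
Qed.

(** * Blue walks and the shortest odd closed one *)

Fixpoint walk (k : nat) (x y : V) : bool :=
  if k is k'.+1 then [exists z, (col x z == Blue) && walk k' z y] else x == y.

Lemma walkD (j k : nat) (x z : V) :
  walk (j + k) x z <-> exists2 y, walk j x y & walk k y z.
Proof.
elim: j x => [|j IHj] x /=; first by split=> [|[y /eqP->]] //; exists x.
split=> [/existsP[y /andP[xy /IHj[w yw wz]]]|[w /existsP[y /andP[xy yw]] wz]].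
  by exists w => //; apply/existsP; exists y; rewrite xy.
by apply/existsP; exists y; rewrite xy; apply/IHj; exists w.
Qed.

Lemma walk1 (x y : V) : walk 1 x y = (col x y == Blue).
Proof.
apply/existsP/idP => [[z /andP[xz /eqP<-]] //|xy].
by exists y; rewrite xy eqxx.
Qed.

Lemma walkC (k : nat) (x y : V) : walk k x y -> walk k y x.
Proof.
elim: k x y => [|k IHk] x y; first by rewrite /= eq_sym.
rewrite -[k.+1]/(1 + k) => /walkD[z]; rewrite walk1 => xz /IHk zy.
by rewrite addnC; apply/walkD; exists z; rewrite ?walk1 1?colC.
Qed.

Lemma walk2_yellow (x y : V) : walk 2 x y -> col x y = Yellow.
Proof.
rewrite -[2]/(1 + 1) => /walkD[z]; rewrite !walk1 => /eqP xz /eqP zy.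
exact: blue2_yellow xz zy.
Qed.

Lemma closed_walk7 (x : V) : walk 7 x x ->
  exists u : nat -> V,
    (forall i, u (i + 7) = u i) /\ forall i, col (u i) (u i.+1) = Blue.
Proof.
do 7![case/existsP=> ? /andP[/eqP ?]] => /eqP e.
match goal with e : ?y6 = x,
  h1 : col x ?y0 = _, h2 : col ?y0 ?y1 = _, h3 : col ?y1 ?y2 = _,
  h4 : col ?y2 ?y3 = _, h5 : col ?y3 ?y4 = _, h6 : col ?y4 ?y5 = _ |- _ =>
  exists (fun i => nth x [:: x; y0; y1; y2; y3; y4; y5] (i %% 7)); subst y6;
  split => i; rewrite ?modnDr // -[i.+1]addn1 -modnDml;
  have: i %% 7 < 7 by rewrite ltn_mod
end.
by case: (i %% 7) => [|[|[|[|[|[|[|]]]]]]].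
Qed.

Section ShortestOddWalk.
Variable m : nat.
Hypothesis m_odd : odd m.
Hypothesis m_min : forall d x, odd d -> d < m -> ~~ walk d x x.

(* x and y are d steps apart on a closed walk of length m. *)
Definition arc (d : nat) (x y : V) : Prop := walk d x y /\ walk (m - d) x y.

Lemma arc_compl (d : nat) (x y : V) : d <= m -> arc d x y -> arc (m - d) x y.
Proof. by move=> dm [? ?]; split; rewrite ?subKn. Qed.

Lemma arcD (d e : nat) (x y : V) : d + e <= m -> arc (d + e) x y ->
  exists2 z, arc d x z & arc e z y.
Proof.
move=> dem [/walkD[z xz zy] xy]; exists z; split=> //.
  rewrite (_ : m - d = m - (d + e) + e); last by lia.
  by apply/walkD; exists y => //; apply: walkC.
rewrite (_ : m - e = d + (m - (d + e))); last by lia.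
by apply/walkD; exists x => //; apply: walkC.
Qed.

(** Since [m] is odd, one of [d] and [m - d] is even; a blue edge would close that walk into an odd
    one, and the bounds on [d] make it shorter than [m]. *)
Lemma arc_not_blue (d : nat) (x y : V) :
  1 < d -> d + 2 <= m -> arc d x y -> col x y <> Blue.
Proof.
move=> d1 dm [xy xy'] b.
have closed k : walk k x y -> ~~ odd k -> k.+1 < m -> False.
  move=> kxy ek km; apply: (negP (m_min x (ek : odd k.+1) km)).
  by rewrite -addn1; apply/walkD; exists y; rewrite ?walk1 // colC b.
case: (boolP (odd d)) => [od|ed]; last by apply: (closed _ xy); lia.
by apply: (closed _ xy'); lia.
Qed.

Definition arcs_colored (d : nat) (a : color) : Prop :=
  forall x y, arc d x y -> col x y = a.

Lemma arcs2 : arcs_colored 2 Yellow.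
Proof. by move=> x y [/walk2_yellow]. Qed.

(** The last step is blue, so [yyb] excludes yellow, and minimality of [m] excludes blue. *)
Lemma arcs_odd (d : nat) : 0 < d -> d + 3 <= m ->
  arcs_colored d Yellow -> arcs_colored d.+1 Red.
Proof.
move=> d0 dm dY x y xy; have := @arc_not_blue d.+1 x y d0 ltac:(lia) xy.
rewrite -addn1 in xy; have [|z xz zy] := arcD _ xy; first by lia.
have := col_ok x z y; rewrite dY //.
by case: zy; rewrite walk1 => /eqP-> _; case: (col x y).
Qed.

(** Two red pieces exclude red through [rrr], and minimality of [m] excludes blue. *)
Lemma arcs_even (d : nat) : d + 5 <= m ->
  arcs_colored d Red -> arcs_colored 3 Red -> arcs_colored (d + 3) Yellow.
Proof.
move=> dm dR R3 x y xy; have := @arc_not_blue (d + 3) x y ltac:(lia) ltac:(lia) xy.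
have [|z xz zy] := arcD _ xy; first by lia.
by have := col_ok x z y; rewrite dR // R3 //; case: (col x y).
Qed.

Lemma shortest_odd_walk (x : V) : m != 7 -> ~~ walk m x x.
Proof.
move=> m7; apply/negP => mxx.
(* Length 1 would need a blue loop, and length 3 a blue triangle. *)
have m5 : 4 < m.
  case: (m) m_odd mxx => [|[|[|[|[|]]]]] //= _.
    by rewrite -[[exists _, _]]/(walk 1 x x) walk1 colxx => /eqP.
  rewrite -[[exists _, _]]/(walk (1 + 2) x x) => /walkD[y].
  rewrite walk1 => /eqP xy /walk2_yellow.
  by rewrite colC xy.
have R3 : arcs_colored 3 Red by apply: arcs_odd arcs2 => //; lia.
(* Distance 4 cannot come from [arcs_even], as distance 1 is blue. The other way around has length
   [m - 4 = 3 + (m - 7)], and [m - 7] is complementary to the red distance 7. *)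
have Y4 : 10 < m -> arcs_colored 4 Yellow.
  move=> m11.
  have Y6 : arcs_colored 6 Yellow by apply: (@arcs_even 3); lia || assumption.
  have R7 : arcs_colored 7 Red by apply: arcs_odd Y6; lia.
  move=> y z yz; have := @arc_not_blue 4 y z ltac:(lia) ltac:(lia) yz.
  have := @arc_compl 4 y z ltac:(lia) yz.
  rewrite (_ : m - 4 = 3 + (m - 7)); last by lia.
  case/arcD => [|w yw wz]; first by lia.
  have wz7 : arc 7 w z.
    have m7_le : 7 <= m by lia.
    by rewrite -(subKn m7_le); apply: arc_compl wz; lia.
  have := col_ok y w z; rewrite R3 // R7 //.
  by case: (col y z).
(* The induction goes from [d - 4] yellow to [d - 3] red to [d] yellow, starting from 2 and 4. For
   [m = 9] only 2 and 6 occur; for [m = 7] the excluded distance 4 is exactly [m - 3]. *)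
have even_yellow d : ~~ odd d -> 1 < d -> d + 3 <= m ->
    d != 4 \/ 10 < m -> arcs_colored d Yellow.
  elim/ltn_ind: d => d IHd ed d1 dm d4m.
  case: (eqVneq d 2) => [->|d2]; first exact: arcs2.
  case: (eqVneq d 4) => [e|d4]; first by rewrite e; apply: Y4; lia.
  rewrite (_ : d = d - 3 + 3); last by lia.
  apply: arcs_even => //; first by lia.
  rewrite (_ : d - 3 = (d - 4).+1); last by lia.
  by apply: arcs_odd; [lia|lia|apply: IHd; lia].
have [y xy yx] : exists2 y, walk 2 x y & walk (m - 2) y x.
  by apply/walkD; rewrite subnKC //; lia.
have a2 : arc 2 x y by split=> //; apply: walkC.
(* Yellow at [m - 3] forces red at [m - 2], the complement of the yellow distance 2. *)
have := arcs2 a2; rewrite (@arcs_odd (m - 3)) //; try by lia.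
  by apply: even_yellow; lia.
by rewrite (_ : (m - 3).+1 = m - 2); [apply: arc_compl; lia || assumption|lia].
Qed.

End ShortestOddWalk.

Lemma no_odd_walk (m : nat) (x : V) :
  (forall y, ~~ walk 7 y y) -> odd m -> ~~ walk m x x.
Proof.
move=> no7; elim/ltn_ind: m x => m IHm x om.
case: (eqVneq m 7) => [->//|m7].
by apply: shortest_odd_walk => // d y od dm; apply: IHm.
Qed.

(** One side consists of the vertices joined to the root of their blue component by an even walk,
    expressed as connectivity under two-step walks. A blue edge inside a side would close an odd
    walk through the root. *)
Lemma blue_bipartite : (forall m x, odd m -> ~~ walk m x x) ->
  exists S : {set V}, avoids Blue S /\ avoids Blue (~: S).
Proof.
move=> no_odd; pose blue := [rel x y | col x y == Blue].
pose walk2 := [rel x y | walk 2 x y].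
have blue_sym : connect_sym blue.
  by apply: sym_connect_sym => x y; rewrite /= colC.
have walk_blue x y : connect blue x y -> exists k, walk k x y.
  case/connectP=> p; elim: p x => [|z p IHp] x /= => [_ ->|/andP[xz zp] /(IHp _ zp)[k zy]].
    by exists 0; rewrite /= eqxx.
  by exists k.+1; apply/existsP; exists z; rewrite xz.
have walk_even x y : connect walk2 x y -> exists k, walk k.*2 x y.
  case/connectP=> p; elim: p x => [|z p IHp] x.
    by move=> _ ->; exists 0; rewrite /= eqxx.
  case/andP=> xz zp /(IHp _ zp)[k zy].
  by exists k.+1; rewrite doubleS -(add2n k.*2); apply/walkD; exists z.
have even_walk k x y : walk k.*2 x y -> connect walk2 x y.
  elim: k x => [|k IHk] x; first by move/eqP->; apply: connect0.
  rewrite doubleS -(add2n k.*2) => /walkD[z xz zy].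
  by apply: connect_trans (IHk _ zy); apply: connect1.
have closed k l x y z : walk k x y -> col y z = Blue -> walk l x z -> odd k = odd l -> False.
  move=> xy yz xz kl.
  have okl : odd (k + (1 + l)) by rewrite !oddD kl; case: (odd l).
  apply: (negP (no_odd _ x okl)).
  by apply/walkD; exists y => //; apply/walkD; exists z; rewrite ?walk1 ?yz //; apply: walkC.
have same_root x y : col x y = Blue -> fingraph.root blue x = fingraph.root blue y.
  by move=> xy; apply/(fingraph.rootP blue_sym)/connect1; rewrite /= xy.
exists [set x | connect walk2 (fingraph.root blue x) x]; split=> x y; rewrite !inE => xS yS xy.
  rewrite (same_root _ _ xy) in xS.
  have [[k xk] [l yl]] := (walk_even _ _ xS, walk_even _ _ yS).
  by apply: closed xk xy yl _; rewrite !odd_double.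
have odd_walk z : ~~ connect walk2 (fingraph.root blue z) z ->
    exists2 k, odd k & walk k (fingraph.root blue z) z.
  move=> nz; have [|k kz] := walk_blue (fingraph.root blue z) z.
    by rewrite blue_sym connect_root.
  exists k => //; apply: contraR nz => ek; apply: (even_walk k./2).
  by rewrite even_halfK.
have [[k ok xk] [l ol yl]] := (odd_walk _ xS, odd_walk _ yS).
rewrite (same_root _ _ xy) in xk.
by apply: closed xk xy yl _; rewrite ok ol.
Qed.

End Structure.

(** * Large two-colored sets in colorings of vertex pairs *)

Definition target (n : nat) : nat := (3 * n + 6) %/ 7 + epsilon1 n.

(** The value [n = 2] is a true exception, as [target 2 = 2]; it is treated in [large_pair]. For
    [n = 9] and [n = 16] the bound is just met. *)
Lemma target_half (n s : nat) : n != 2 -> n <= 2 * s -> target n <= s.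
Proof. by rewrite /target /epsilon1 => n2 ns; case: ifP => /eqP; lia. Qed.

Lemma target_heptagon (w : nat -> nat) (n : nat) :
  n = w 0 + (w 1 + (w 2 + (w 3 + (w 4 + (w 5 + w 6))))) ->
  exists i, i < 7 /\
    (target n <= w i + (w (i.+1 %% 7) + w (i.+2 %% 7)) \/
     target n <= w i + (w (i.+2 %% 7) + w (i.+4 %% 7))).
Proof.
move=> nE; pose good i := (target n <= w i + (w (i.+1 %% 7) + w (i.+2 %% 7)))
  || (target n <= w i + (w (i.+2 %% 7) + w (i.+4 %% 7))).
case: (boolP (has good (iota 0 7))) => [/hasP[i]|].
  by rewrite mem_iota => /andP[_ i7] /orP; exists i.
rewrite /= /good -[7 %% 7]/0 -[8 %% 7]/1 -[9 %% 7]/2 -[10 %% 7]/3.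
rewrite !modn_small // !negb_or -!ltnNge.
rewrite /target /epsilon1; case: ifP => /eqP n2; last by lia.
(* If all triples had at most [3k + 1] vertices, each family, summing to [21k + 6], would have a
   single triple below [3k + 1], by one. That forces five parts of size [k] and two of size [k + 1];
   the first family puts the larger two at difference 3, the second at difference 1. *)
have [k nk] : exists k, n = 7 * k + 2 by exists (n %/ 7); lia.
rewrite (_ : (3 * n + 6) %/ 7 + 1 = 3 * k + 2); last by lia.
by clear n2; lia.
Qed.

Section LargeSet.
Variables (V : finType) (col : V -> V -> color).
Hypotheses (colC : forall x y, col x y = col y x) (colxx : forall x, col x x = Yellow).
Hypothesis col_ok : forall x y z, allowed (col x y) (col y z) (col x z).

Let large : Prop := exists (a : color) (S : {set V}),
  {in S &, forall x y, x != y -> col x y <> a} /\ target #|V| <= #|S|.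

Lemma large_avoids (a : color) (S : {set V}) :
  avoids col a S -> target #|V| <= #|S| -> large.
Proof. by move=> aS tS; exists a, S; split=> // x y xS yS _; apply: aS. Qed.

Lemma large_bipartition (a : color) (S : {set V}) : #|V| != 2 ->
  avoids col a S -> avoids col a (~: S) -> large.
Proof.
move=> V2 aS aS'; have := cardsC S => SV.
have tV : target #|V| <= #|S| \/ target #|V| <= #|~: S|.
  case: (leqP #|S| #|~: S|) => [le_S|lt_S]; [right|left].
    by apply: target_half => //; rewrite -SV mul2n -addnn leq_add2r.
  by apply: target_half => //; rewrite -SV mul2n -addnn leq_add2l ltnW.
by case: tV; apply: large_avoids; eassumption.
Qed.

Lemma large_pair : #|V| = 2 -> large.
Proof.
rewrite -cardsT => V2; have /cards2P[p [q [pq Vpq]]] : #|[set: V]| == 2 by rewrite V2.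
exists (if col p q is Red then Blue else Red), setT; split; last by rewrite V2 -cardsT V2.
move=> x y; rewrite Vpq !inE => /orP[]/eqP-> /orP[]/eqP->; rewrite ?eqxx // => _;
  by rewrite ?(colC q); case: (col p q).
Qed.

Lemma large_blowup (t : V -> 'I_7) :
  (forall x y, col x y = heptagon (t x) (t y)) -> large.
Proof.
move=> tP; pose w i := #|[set x | t x == i :> nat]|.
have cardS s : uniq s -> #|[set x | nat_of_ord (t x) \in s]| = \sum_(i <- s) w i.
  elim: s => [|i s IHs] /= => [_|/andP[nis us]].
    by rewrite big_nil; apply: eq_card0 => x; rewrite inE.
  rewrite big_cons -IHs // -cardsUI [X in _ + X]eq_card0 ?addn0.
    by apply: eq_card => x; rewrite !inE.
  by move=> x; rewrite !inE; apply/andP => -[/eqP->]; rewrite (negPf nis).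
have Vw : #|V| = \sum_(i <- iota 0 7) w i.
  rewrite -cardS ?iota_uniq // -cardsT; apply: eq_card => x.
  by rewrite in_set mem_iota ltn_ord in_setT.
(* The pairs with [i = j] are tested too, so that whole parts may be taken. *)
pose ok a s := uniq s && all (fun i => all (fun j => ~~ same_color (heptagon i j) a) s) s.
have largeP a s : ok a s -> target #|V| <= \sum_(i <- s) w i -> large.
  case/andP => us /allP s_ok; rewrite -cardS // => tS.
  apply: (large_avoids (a := a)) tS => x y.
  rewrite !inE tP => xs ys.
  by have /allP/(_ _ ys)/same_colorP := s_ok _ xs.
have okR i : i < 7 -> ok Red [:: i; i.+1 %% 7; i.+2 %% 7].
  by case: i => [|[|[|[|[|[|[|]]]]]]].
have okB i : i < 7 -> ok Blue [:: i; i.+2 %% 7; i.+4 %% 7].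
  by case: i => [|[|[|[|[|[|[|]]]]]]].
have [|i [i7]] := @target_heptagon w #|V|; first by rewrite Vw !big_cons big_nil addn0.
by case=> ti; [apply: largeP (okR i i7) _|apply: largeP (okB i i7) _];
  rewrite !big_cons big_nil addn0.
Qed.

Lemma large_set : large.
Proof.
case: (eqVneq #|V| 2) => [/large_pair //|V2].
case: (boolP [exists p : V * V * V, [&& col p.1.1 p.1.2 == Blue,
    col p.1.2 p.2 == Blue & col p.1.1 p.2 == Blue]]).
  case/existsP => -[[x y] z] /and3P[/eqP/= xy /eqP/= yz /eqP/= xz].
  have [S [aS aS']] := blue_triangle_avoids col_ok xy yz xz.
  exact: large_bipartition aS aS'.
move/existsPn => no_triangle.
have no_blue_triangle x y z : col x y = Blue -> col y z = Blue -> col x z <> Blue.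
  by move=> xy yz xz; have := no_triangle (x, y, z); rewrite /= xy yz xz eqxx.
case: (boolP [exists x, walk col 7 x x]) => [/existsP[x]|/existsPn no7].
  case/closed_walk7 => u [u7 u1].
  have [t tP] := heptagon_blowup colC col_ok (blue_heptagon colC colxx col_ok no_blue_triangle u7 u1).
  exact: large_blowup tP.
have [S [aS aS']] := blue_bipartite colC (fun m x =>
  @no_odd_walk V col colC colxx col_ok no_blue_triangle m x no7).
exact: large_bipartition aS aS'.
Qed.
End LargeSet.

(** * Edge-colorings as symmetric functions of two vertices *)

Lemma card_color : #|{: color}| = 3.
Proof.
rewrite -[RHS](card_ord 3); apply: (bij_eq_card (f := color_to_ord)).
exists ord_to_color; first exact: color_to_ordK.
by case=> -[|[|[|]]] // i3; apply: val_inj; rewrite /ord_to_color /= inordK.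
Qed.

Definition forbidden : seq pattern :=
  [:: [tuple Red; Red; Red]; [tuple Blue; Blue; Red]; [tuple Yellow; Yellow; Blue]].

Lemma allowedE (a b c : color) :
  allowed a b c = ~~ has (fun p : pattern => perm_eq [:: a; b; c] p) forbidden.
Proof.
have eqE (x y : color) : (x == y) = same_color x y by apply/eqP/same_colorP.
by rewrite /perm_eq /= !eqE; case: a; case: b; case: c.
Qed.

Section Bridge.
Variable n : nat.
Implicit Types (c : coloring n) (x y z : 'I_n).

(* With Yellow on the diagonal, every degenerate triangle is allowed. *)
Definition edge_color c x y : color :=
  if insub [set x; y] is Some e then c e else Yellow.

Lemma edge_colorC c x y : edge_color c x y = edge_color c y x.
Proof. by rewrite /edge_color setUC. Qed.

Lemma edge_colorxx c x : edge_color c x x = Yellow.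
Proof. by rewrite /edge_color setUid insubF // cards1. Qed.

Lemma edge_colorE c x y (e : edge n) : val e = [set x; y] -> edge_color c x y = c e.
Proof. by rewrite /edge_color => <-; rewrite valK. Qed.

Lemma edge_exists x y : x != y -> exists e : edge n, val e = [set x; y].
Proof.
move=> xy; have xy2 : #|[set x; y]| == 2 by rewrite cards2 xy.
by exists (exist _ [set x; y] xy2).
Qed.

Lemma card_color_setP c (S : {set 'I_n}) :
  (#|color_set c S| <= 2) <->
  exists a, {in S &, forall x y, x != y -> edge_color c x y <> a}.
Proof.
split=> [S2|[a aS]].
  have [a aS] : exists a, a \notin color_set c S.
    apply/existsP; rewrite -negb_forall; apply: contraL S2 => /forallP Sall.
    rewrite -ltnNge -card_color -cardsT; apply/subset_leq_card/subsetP => a _.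
    exact: Sall.
  exists a => x y xS yS xy cxy; have [e eE] := edge_exists xy.
  case/imsetP: aS; exists e; last by rewrite -cxy (edge_colorE c eE).
  by rewrite inE eE; apply/subsetP => z; rewrite !inE => /orP[]/eqP->.
apply: leq_trans (_ : #|[set~ a]| <= 2); last by rewrite cardsC1 card_color.
apply/subset_leq_card/subsetP => b /imsetP[e eS ->]; rewrite !inE in eS *.
have /cards2P[x [y [xy eE]]] := valP e.
apply/eqP; rewrite -(edge_colorE c eE); move/subsetP: eS => eS.
by apply: aS => //; apply: eS; rewrite eE !inE eqxx ?orbT.
Qed.

Lemma edge_colors_triangle c x y z : x != y -> y != z -> x != z ->
  perm_eq (edge_colors c [set x; y; z])
          [:: edge_color c x y; edge_color c y z; edge_color c x z].
Proof.
move=> xy yz xz.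
have [[e1 E1] [[e2 E2] [e3 E3]]] := (edge_exists xy, (edge_exists yz, edge_exists xz)).
rewrite (edge_colorE c E1) (edge_colorE c E2) (edge_colorE c E3).
rewrite -[X in perm_eq _ X]/(map c [:: e1; e2; e3]); apply: perm_map.
have [yx zy zx] : [/\ y != x, z != y & z != x] by split; rewrite eq_sym.
have eq_edge (e e' : edge n) : (e == e') = (val e == val e') by rewrite val_eqE.
apply: uniq_perm; first by rewrite filter_uniq ?enum_uniq.
  rewrite /= !inE !eq_edge E1 E2 E3 andbT negb_or.
  apply/andP; split; first (apply/andP; split); apply/eqP => /setP E.
  - by have := E x; rewrite !inE eqxx (negPf xy) (negPf xz).
  - by have := E y; rewrite !inE eqxx (negPf yx) (negPf yz).
  - by have := E y; rewrite !inE eqxx (negPf yx) (negPf yz).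
move=> e; rewrite mem_filter mem_enum andbT !inE !eq_edge E1 E2 E3.
have /cards2P[p [q [pq ->]]] := valP e.
apply/idP/or3P => [/subsetP sub|]; last first.
  by case=> /eqP->; apply/subsetP => w; rewrite !inE => /orP[]->; rewrite ?orbT.
have := sub p; have := sub q; rewrite !inE !eqxx orbT => /(_ isT) qT /(_ isT) pT.
by case/orP: pT pq => [/orP[]|] /eqP-> ; case/orP: qT => [/orP[]|] /eqP->;
  rewrite ?eqxx // => _; rewrite ?eqxx; try (by [constructor 1|constructor 2|constructor 3]);
  rewrite setUC ?eqxx; try (by [constructor 1|constructor 2|constructor 3]).
Qed.

Lemma card_triangle x y z : x != y -> y != z -> x != z -> #|[set x; y; z]| = 3.
Proof.
by move=> xy yz xz; rewrite setUC cardsU1 cards2 xy !inE negb_or !(eq_sym z) xz yz.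
Qed.

Lemma ForbP c : c \in Forb n forbidden <->
  forall x y z, allowed (edge_color c x y) (edge_color c y z) (edge_color c x z).
Proof.
rewrite inE; split=> [/forallP c_ok x y z|c_ok].
  case: (eqVneq x y) => [->|xy]; first by rewrite edge_colorxx; case: (edge_color _ _ _).
  case: (eqVneq y z) => [->|yz]; first by rewrite edge_colorxx; case: (edge_color _ _ _).
  case: (eqVneq x z) => [->|xz].
    by rewrite edge_colorxx (edge_colorC c y); case: (edge_color _ _ _).
  have /implyP := c_ok [set x; y; z]; rewrite card_triangle // allowedE => /(_ isT).
  apply: contra => /hasP[p pH pP]; apply/hasP; exists p => //.
  by rewrite (permPl (edge_colors_triangle c xy yz xz)).
apply/forallP => T; apply/implyP => /eqP T3.
have /card_gt2P[x [y [z [[xT yT zT] [xy yz zx]]]]] : 2 < #|T| by rewrite T3.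
have xz : x != z by rewrite eq_sym.
have -> : T = [set x; y; z].
  apply/esym/eqP; rewrite eqEcard T3 card_triangle // andbT.
  by apply/subsetP => w; rewrite !inE => /orP[/orP[]|]/eqP->.
have := c_ok x y z; rewrite allowedE; apply: contra => /hasP[p pH pP].
apply/hasP; exists p => //.
by rewrite -(permPl (edge_colors_triangle c xy yz xz)).
Qed.

(** An edge is an unordered pair, so an ordering of it is picked; [coloring_ofE] shows that for
    symmetric [f] the choice is immaterial. Every edge has two ends, so the default [Red] is never
    taken. *)
Definition coloring_of (f : 'I_n -> 'I_n -> color) : coloring n :=
  [ffun e : edge n =>
     if [pick p : 'I_n * 'I_n | val e == [set p.1; p.2]] is Some p
     then f p.1 p.2 else Red].

Lemma coloring_ofE (f : 'I_n -> 'I_n -> color) x y :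
  (forall x y, f x y = f y x) -> (forall x, f x x = Yellow) ->
  edge_color (coloring_of f) x y = f x y.
Proof.
move=> fC fxx; case: (eqVneq x y) => [->|xy]; first by rewrite edge_colorxx fxx.
have [e E] := edge_exists xy; rewrite (edge_colorE _ E) ffunE.
case: pickP => [[p q] /= /eqP|/(_ (x, y))]; last by rewrite /= E eqxx.
rewrite E => /setP Epq.
have := Epq p; have := Epq q; have := Epq x; have := Epq y.
rewrite !inE !eqxx !orbT /= => /esym/orP[]/eqP ? /esym/orP[]/eqP ?; subst => //.
- by rewrite eqxx in xy.
- by rewrite eqxx in xy.
Qed.

End Bridge.

(** * The lower bound, and colorings attaining it *)

Lemma h2_lower (n : nat) (c : coloring n) : c \in Forb n forbidden -> target n <= h2 c.
Proof.
move=> /ForbP c_ok.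
have [a [S [aS]]] := large_set (edge_colorC c) (edge_colorxx c) c_ok.
rewrite card_ord => /leq_trans; apply; apply: leq_bigmax_cond.
by apply/card_color_setP; exists a.
Qed.

Lemma Forb_coloring_of (n m : nat) (f : 'I_n -> 'I_n -> color) :
  (forall x y, f x y = f y x) -> (forall x, f x x = Yellow) ->
  (forall x y z, allowed (f x y) (f y z) (f x z)) ->
  (forall a (S : {set 'I_n}), {in S &, forall x y, x != y -> f x y <> a} -> #|S| <= m) ->
  coloring_of f \in Forb n forbidden /\ h2 (coloring_of f) <= m.
Proof.
move=> fC fxx f_ok f_small; split.
  by apply/ForbP => x y z; rewrite !coloring_ofE.
apply/bigmax_leqP => S /card_color_setP[a aS]; apply: (f_small a) => x y xS yS xy.
by rewrite -(coloring_ofE x y fC fxx); apply: aS.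
Qed.

(** The sums 1 and 5, 2 and 4, and 3 single out the three perfect matchings of [K_4], so every
    triangle carries all three colors. *)
Definition clique4 (i j : nat) : color :=
  if i == j then Yellow else
  match i + j with 1 | 5 => Red | 2 | 4 => Blue | _ => Yellow end.

Lemma Forb_small_h2_le4 (n : nat) : 0 < n -> n <= 4 ->
  exists2 c, c \in Forb n forbidden & h2 c <= target n.
Proof.
move=> n_gt0 n4.
have lt4 (x : 'I_n) : x < 4 by apply: leq_trans n4.
have clique4C i j : clique4 i j = clique4 j i by rewrite /clique4 eq_sym addnC.
pose distinct (i j k : nat) := [&& i != j, j != k & i != k].
have ok : all (fun i => all (fun j => all (fun k =>
    allowed (clique4 i j) (clique4 j k) (clique4 i k) &&
    (distinct i j k ==> all (fun a => has (same_color a)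
        [:: clique4 i j; clique4 j k; clique4 i k]) colors))
    (iota 0 4)) (iota 0 4)) (iota 0 4) by vm_compute.
have {ok} clique4_ok (x y z : 'I_n) : allowed (clique4 x y) (clique4 y z) (clique4 x z) /\
    (distinct x y z -> forall a, has (same_color a) [:: clique4 x y; clique4 y z; clique4 x z]).
  have /allP/(_ x) := ok; rewrite mem_iota => /(_ (lt4 x)).
  move=> /allP/(_ y); rewrite mem_iota => /(_ (lt4 y)).
  move=> /allP/(_ z); rewrite mem_iota => /(_ (lt4 z))/andP[? /implyP xyz].
  by split=> // /xyz /allP H a; apply: H; apply: mem_colors.
have [||||cF c_le] := @Forb_coloring_of n (target n) (fun x y => clique4 x y).
- by move=> x y; apply: clique4C.
- by move=> x; rewrite /clique4 eqxx.
- by move=> x y z; case: (clique4_ok x y z).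
- move=> a S aS.
  (* For [n] from 1 to 4, [minn n 2] is exactly [target n]. *)
  have : #|S| <= minn n 2.
    rewrite leq_min -[X in (_ <= X) && _]card_ord max_card /= leqNgt.
    apply/card_gt2P => -[x [y [z [[xS yS zS] [xy yz zx]]]]].
    have [_ /(_ _ a)] := clique4_ok x y z; rewrite /distinct xy yz.
    rewrite (eq_sym (x : nat)) zx => /(_ isT).
    rewrite /= orbF => /or3P[]/same_colorP e.
    - by apply: (aS x y).
    - by apply: (aS y z).
    - by apply: (aS x z); rewrite // eq_sym.
  move=> /leq_trans; apply.
  by case: n n_gt0 n4 {lt4 clique4_ok S aS} => [|[|[|[|[|]]]]].
by exists (coloring_of (fun x y : 'I_n => clique4 x y)).
Qed.

(* When n = j modulo 7, the classes of the residues i < j have one extra vertex;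
   in this order, for every j, few of them lie in a common two-colored set. *)
Definition vertex_class (i : nat) : nat := nth 0 [:: 0; 4; 5; 1; 2; 3; 6] i.

Lemma vertex_class_lt (i : nat) : vertex_class i < 7.
Proof. by rewrite /vertex_class; case: i => [|[|[|[|[|[|[|i]]]]]]] //=; rewrite nth_nil. Qed.

(** Here [b] marks the residues met by a set missing the color [a]; all [2^7] markings are tested.
    The listed bounds are the values [target j] for [j < 7], and
    [target (7 * k + j) = 3 * k + target j]. *)
Lemma two_colored_classes (a : color) (b : pred nat) :
  (forall i j, i < 7 -> j < 7 -> i != j -> b i -> b j ->
     heptagon (vertex_class i) (vertex_class j) <> a) ->
  count b (iota 0 7) <= 3 /\
  (a <> Yellow -> forall j, j < 7 ->
     count b (iota 0 j) <= nth 0 [:: 0; 1; 2; 2; 2; 3; 3] j).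
Proof.
pose ok a (w : bitseq) := all (fun i => all (fun j =>
  [&& i != j, nth false w i & nth false w j] ==>
  ~~ same_color (heptagon (vertex_class i) (vertex_class j)) a) (iota 0 7)) (iota 0 7).
pose small a (w : bitseq) := (count (nth false w) (iota 0 7) <= 3) &&
  (same_color a Yellow || all (fun j => count (nth false w) (iota 0 j) <=
     nth 0 [:: 0; 1; 2; 2; 2; 3; 3] j) (iota 0 7)).
have: all (fun a => all (fun w => ok a w ==> small a w) (words [:: true; false] 7)) colors.
  by vm_compute.
move=> /allP/(_ a (mem_colors a))/allP check b_ok.
have nthb j : j < 7 -> nth false [seq b i | i <- iota 0 7] j = b j.
  by move=> j7; rewrite (nth_map 0) ?size_iota // nth_iota.
have countb j : j <= 7 ->
    count (nth false [seq b i | i <- iota 0 7]) (iota 0 j) = count b (iota 0 j).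
  move=> j7; apply: eq_in_count => i; rewrite mem_iota => /andP[_ ij].
  by apply: nthb; apply: leq_trans ij j7.
have bw : [seq b i | i <- iota 0 7] \in words [:: true; false] 7.
  apply: (@mem_words _ [:: true; false] (map b (iota 0 7))) => x _.
  by case: x.
have w_ok : ok a [seq b i | i <- iota 0 7].
  apply/allP => i; rewrite mem_iota => /andP[_ i7].
  apply/allP => j; rewrite mem_iota => /andP[_ j7].
  rewrite !nthb //; apply/implyP => /and3P[ij bi bj].
  by apply/same_colorP; apply: b_ok.
have := check _ bw; rewrite w_ok => /andP[].
rewrite countb // => -> /orP[/same_colorP->//|/allP smallw]; split=> // _ j j7.
by rewrite -countb ?(ltnW j7) //; apply: smallw; rewrite mem_iota.
Qed.

(** The numbers below [n] form [n %/ 7] full rounds of residues and a last round with the residues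
    below [n %% 7]. *)
Lemma size_residues (n : nat) (s : seq nat) (b : pred nat) : uniq s ->
  (forall x, x \in s -> x < n /\ b (x %% 7)) ->
  size s <= n %/ 7 * count b (iota 0 7) + count b (iota 0 (n %% 7)).
Proof.
move=> us sP.
pose below := [seq 7 * q + i | q <- iota 0 (n %/ 7), i <- filter b (iota 0 7)].
pose above := [seq 7 * (n %/ 7) + i | i <- filter b (iota 0 (n %% 7))].
have: {subset s <= below ++ above}; last first.
  by move/(uniq_leq_size us); rewrite size_cat size_allpairs size_map !size_filter size_iota.
move=> x /sP[xn bx].
rewrite mem_cat; case: (ltnP (x %/ 7) (n %/ 7)) => [x7|x7]; apply/orP; [left|right].
  rewrite /below (divn_eq x 7) mulnC; apply: allpairs_f; first by rewrite mem_iota.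
  by rewrite mem_filter bx mem_iota ltn_mod.
apply/mapP; exists (x %% 7); last by lia.
by rewrite mem_filter bx mem_iota /=; lia.
Qed.

Lemma Forb_small_h2_gt4 (n : nat) : 4 < n ->
  exists2 c, c \in Forb n forbidden & h2 c <= target n.
Proof.
move=> n4; pose f (x y : 'I_n) := heptagon (vertex_class (x %% 7)) (vertex_class (y %% 7)).
have hepxx i : heptagon i i = Yellow by rewrite /heptagon addnC addnK modnn.
have ok : all (fun i => all (fun j => all (fun k =>
    allowed (heptagon i j) (heptagon j k) (heptagon i k))
    (iota 0 7)) (iota 0 7)) (iota 0 7) by vm_compute.
have [||||cF c_le] := @Forb_coloring_of n (target n) f.
- by move=> x y; apply: heptagonC; apply: vertex_class_lt.
- by move=> x; apply: hepxx.
- move=> x y z.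
  have /allP/(_ (vertex_class (x %% 7))) := ok; rewrite mem_iota => /(_ (vertex_class_lt _)).
  move=> /allP/(_ (vertex_class (y %% 7))); rewrite mem_iota => /(_ (vertex_class_lt _)).
  by move=> /allP/(_ (vertex_class (z %% 7))); rewrite mem_iota => /(_ (vertex_class_lt _)).
- move=> a S aS; pose b i := [exists x in S, x %% 7 == i].
  have b_mod x : x \in S -> b (x %% 7) by move=> xS; apply/exists_inP; exists x.
  have [|b3 bT] := @two_colored_classes a b.
    move=> i j _ _ ij /exists_inP[x xS /eqP xi] /exists_inP[y yS /eqP yj].
    by rewrite -xi -yj; apply: aS => //; apply: contra_neq ij => xy; rewrite -xi -yj xy.
  (* Classes are yellow inside, so a set missing yellow has at most one vertex in each of at most 3
     classes; [n > 4] gives [target n >= 3]. *)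
  case: (same_colorP a Yellow) => [aY|/bT {}bT].
    have: #|S| <= 3.
      apply: leq_trans b3; rewrite -size_filter cardE.
      rewrite -(size_map (fun x : 'I_n => x %% 7)); apply: uniq_leq_size.
        rewrite map_inj_in_uniq ?enum_uniq // => x y; rewrite !mem_enum => xS yS xy.
        by apply/eqP/negPn/negP => /(aS _ _ xS yS); rewrite /f xy hepxx aY.
      move=> i /mapP[x]; rewrite mem_enum => xS ->.
      by rewrite mem_filter b_mod // mem_iota ltn_mod.
    by move/leq_trans; apply; rewrite /target; lia.
  have uS : uniq (map val (enum S)) by rewrite (map_inj_uniq val_inj) enum_uniq.
  have := size_residues (n := n) (b := b) uS; rewrite size_map -cardE.
  move=> /(_ _)/leq_trans; apply=> [x /mapP[y]|].
    by rewrite mem_enum => yS ->; rewrite b_mod ?ltn_ord.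
  move: (bT _ (ltn_pmod n (isT : 0 < 7))) b3; rewrite /target /epsilon1.
  move: (count b (iota 0 7)) (count b (iota 0 (n %% 7))) => A B BT A3.
  have : n %/ 7 * A <= n %/ 7 * 3 by rewrite leq_mul2l A3 orbT.
  move: BT (divn_eq n 7) (ltn_pmod n (isT : 0 < 7)).
  move: (n %/ 7 * A) (n %/ 7) (n %% 7) => kA k j.
  case: ifP => /eqP;
  case: j => [|[|[|[|[|[|[|]]]]]]] //= ; lia.
by exists (coloring_of f).
Qed.

(** * The exact value and its form with a rational ceiling *)

Lemma h2_minE (n : nat) : 0 < n -> h2_min n forbidden = target n.
Proof.
move=> n_gt0; apply/eqP; rewrite eqn_leq.
have [c cF c_le] : exists2 c, c \in Forb n forbidden & h2 c <= target n.
  by case: (leqP n 4); [apply: Forb_small_h2_le4 | apply: Forb_small_h2_gt4].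
rewrite (leq_trans (h2_min_le cF) c_le) /=.
have [|c' c'F <-] := @h2_min_attained n forbidden; first by apply/set0Pn; exists c.
exact: h2_lower.
Qed.

Import Order.TTheory GRing.Theory Num.Theory.
Local Open Scope ring_scope.

Lemma ceil_3n7 (n : nat) : Num.ceil (3 * n%:R / 7 : rat) = ((3 * n + 6) %/ 7)%N%:Z.
Proof.
set m := ((3 * n + 6) %/ 7)%N.
have [lo hi] : (3 * n <= 7 * m)%N /\ (7 * m <= 3 * n + 6)%N by rewrite /m; lia.
rewrite -(ler_nat rat) !natrM in lo; rewrite -(ler_nat rat) natrD !natrM in hi.
apply: ceil_def; rewrite intrB -pmulrn.
by apply/andP; split; lra.
Qed.

Theorem lemma3p22 (n : nat) (n_gt0 : (0 < n)%N) :
  (h2_min n [:: [tuple Red; Red; Red]; [tuple Blue; Blue; Red];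
                [tuple Yellow; Yellow; Blue]])%:Z
  = Num.ceil (3 * n%:R / 7 : rat) + (epsilon1 n)%:Z.
Proof. by rewrite -[X in h2_min n X]/forbidden h2_minE // ceil_3n7. Qed.
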